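(* Let $\Gamma$ be a group and $M$ a $\Gamma$-monoid. Let $J$ be a proper subset of $M$. Then $J$ is a prime $\Gamma$-order ideal of $M$ if and only if $\mathcal F_J:=M\setminus J$ is a prime $\Gamma$-filter of $M$. Moreover, the map $\phi:\operatorname{Spec}_\Gamma(M)\to \mathscr{PF}il(M)$ defined by $\phi(J):=\mathcal F_J$ is a homeomorphism.
   Context: All monoids are commutative, written additively. The algebraic preorder on $M$ is: $x\le y$ iff $y=x+z$ for some $z\in M$. A $\Gamma$-monoid is a monoid with an action of the group $\Gamma$ by monoid automorphisms, written ${}^\gamma x$; the semiring $\mathbb N[\Gamma]$ ($\mathbb N\ni0$) acts by ${}^{(\sum n_i\gamma_i)}x=\sum n_i\,{}^{\gamma_i}x$. A $\Gamma$-order ideal is a submonoid that is a down-set for $\le$ and closed under $\Gamma$. A proper $\Gamma$-order ideal $P$ is prime if for $\Gamma$-order ideals $J_1,J_2$, $J_1\cap J_2\subseteq P$ implies $J_1\subseteq P$ or $J_2\subseteq P$. $\operatorname{Spec}_\Gamma(M)$ is the set of prime $\Gamma$-order ideals with the topology whose closed sets are $V(J)=\{P:J\subseteq P\}$, $J$ a $\Gamma$-order ideal. A nonempty subset $\mathcal F\subseteq M$ is a $\Gamma$-filter if: (F1) $0\notin\mathcal F$ and $\mathcal F$ is closed under the action of $\Gamma$; (F2) if $x\in\mathcal F$, $y\in M$ and $y\ge x$, then $y\in\mathcal F$; (F3) for any $x,y\in\mathcal F$ there exist $\alpha,\beta\in\mathbb N[\Gamma]$ and $z\in\mathcal F$ with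 ${}^\alpha x\ge z$ and ${}^\beta y\ge z$. A $\Gamma$-filter $\mathcal F$ is prime if $x+y\in\mathcal F$ implies $x\in\mathcal F$ or $y\in\mathcal F$. $\mathscr{F}il(M)$ is the set of all $\Gamma$-filters with the topology having as a basis the sets $\mathscr D(J)=\{\mathcal F\in\mathscr Fil(M): J\cap\mathcal F\ne\emptyset\}$, $J$ a $\Gamma$-order ideal of $M$; $\mathscr{PF}il(M)$ is the set of prime $\Gamma$-filters with the subspace topology. *)

(* Defs.v *)
From HB Require Import structures.
From mathcomp Require Import all_boot all_order all_algebra finmap.
From mathcomp Require Import all_classical topology.

Set Implicit Arguments.
Unset Strict Implicit.
Unset Printing Implicit Defensive.

Import GRing.Theory.

Local Open Scope classical_set_scope.
Local Open Scope ring_scope.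

HB.mixin Record isGammaMonoid (Gamma : groupType) M of GRing.Nmodule M := {
  gact : Gamma -> M -> M;
  gact1 : forall x, gact 1%g x = x;
  gactM : forall (a b : Gamma) x, gact (a * b)%g x = gact a (gact b x);
  gact0 : forall a : Gamma, gact a 0 = 0;
  gactD : forall a : Gamma, {morph gact a : x y / x + y}
}.

#[short(type="gammaMonoidType")]
HB.structure Definition GammaMonoid (Gamma : groupType) :=
  {M of isGammaMonoid Gamma M & GRing.Nmodule M}.

Definition alg_le (M : nmodType) (x y : M) : Prop := exists z, y = x + z.

(* Elements of N[Gamma] are formal sums \sum_i n_i gamma_i, i.e. finitely
   supported functions Gamma -> nat; only their action on M is needed, not
   the multiplication of the semiring. *)
Definition natGroupRing (Gamma : groupType) := {fsfun Gamma -> nat with 0%N}.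

Definition sact (Gamma : groupType) (M : gammaMonoidType Gamma)
    (a : natGroupRing Gamma) (x : M) : M :=
  \sum_(g <- finsupp a) gact g x *+ a g.

Section IdealsAndFilters.
Variables (Gamma : groupType) (M : gammaMonoidType Gamma).
Implicit Types J P F : set M.

Definition gamma_order_ideal J : Prop :=
  [/\ J 0,
      forall x y, J x -> J y -> J (x + y),
      forall x y, alg_le x y -> J y -> J x &
      forall (g : Gamma) x, J x -> J (gact g x)].

Definition prime_gamma_order_ideal P : Prop :=
  [/\ gamma_order_ideal P,
      P <> setT &
      forall J1 J2, gamma_order_ideal J1 -> gamma_order_ideal J2 ->
        J1 `&` J2 `<=` P -> J1 `<=` P \/ J2 `<=` P].

Definition gamma_filter F : Prop :=
  [/\ F !=set0,
      ~ F 0 /\ (forall (g : Gamma) x, F x -> F (gact g x)),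
      forall x y, F x -> alg_le x y -> F y &
      forall x y, F x -> F y -> exists (a b : natGroupRing Gamma) (z : M),
        [/\ F z, alg_le z (sact a x) & alg_le z (sact b y)]].

Definition prime_gamma_filter F : Prop :=
  gamma_filter F /\ (forall x y, F (x + y) -> F x \/ F y).

End IdealsAndFilters.

Section IdealFacts.
Variables (Gamma : groupType) (M : gammaMonoidType Gamma).
Implicit Types J F : set M.

Lemma gamma_order_idealT : gamma_order_ideal [set: M].
Proof. by []. Qed.

Lemma gamma_order_idealI J1 J2 : gamma_order_ideal J1 -> gamma_order_ideal J2 ->
  gamma_order_ideal (J1 `&` J2).
Proof.
move=> [z1 a1 d1 g1] [z2 a2 d2 g2]; split.
- by split.
- by move=> x y [? ?] [? ?]; split; [exact: a1|exact: a2].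
- by move=> x y xy [? ?]; split; [exact: d1 xy _|exact: d2 xy _].
- by move=> g x [? ?]; split; [exact: g1|exact: g2].
Qed.

Lemma gamma_order_ideal_smallest (A : set M) :
  gamma_order_ideal (smallest (@gamma_order_ideal Gamma M) A).
Proof.
split.
- by move=> J [[]].
- by move=> x y Ax Ay J JA; case: (JA) => -[_ aJ _ _] _; apply: aJ; [exact: Ax|exact: Ay].
- by move=> x y xy Ay J JA; case: (JA) => -[_ _ dJ _] _; apply: dJ xy _; exact: Ay.
- by move=> g x Ax J JA; case: (JA) => -[_ _ _ gJ] _; apply: gJ; exact: Ax.
Qed.

Lemma gamma_order_ideal_sact J (a : natGroupRing Gamma) x :
  gamma_order_ideal J -> J x -> J (sact a x).
Proof.
move=> [J0 JD _ Jg] Jx; rewrite /sact.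
apply: (big_ind J) => // g _.
by elim: (a g) => [|n IHn]; rewrite ?mulr0n// mulrS; apply: JD => //; exact: Jg.
Qed.

End IdealFacts.

Section Spectrum.
Variables (Gamma : groupType) (M : gammaMonoidType Gamma).

Definition Spec : Type := [set P : set M | prime_gamma_order_ideal P].

Definition Spec_ideal (P : Spec) : set M := set_val P.

Definition SpecV (J : set M) : set Spec := [set P | J `<=` Spec_ideal P].

Definition Spec_open : set_system Spec :=
  [set U | exists2 J, gamma_order_ideal J & ~` U = SpecV J].

Lemma Spec_openT : Spec_open setT.
Proof.
exists setT; first exact: gamma_order_idealT.
rewrite setCT; apply/seteqP; split=> // P TP.
by case: (set_valP P) => _ PT _; apply: PT; apply/seteqP.
Qed.

Lemma Spec_openI : setI_closed Spec_open.
Proof.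
move=> A B [J1 J1i AE] [J2 J2i BE].
exists (J1 `&` J2); first exact: gamma_order_idealI.
rewrite setCI AE BE; apply/seteqP; split=> P.
  by case=> JP x [? ?]; exact: JP.
by case: (set_valP P) => _ _ Pp /Pp; apply.
Qed.

Lemma Spec_open_bigU (I : Type) (f : I -> set Spec) :
  (forall i, Spec_open (f i)) -> Spec_open (\bigcup_i f i).
Proof.
move=> /(_ _)/cid2-/all_sig2[J Ji fE].
exists (smallest (@gamma_order_ideal Gamma M) (\bigcup_i J i)).
  exact: gamma_order_ideal_smallest.
rewrite setC_bigcup; apply/seteqP; split=> P.
  move=> fP x; apply; split; first by case: (set_valP P).
  by move=> y [i _]; have := fP i Logic.I; rewrite fE; apply.
move=> JP i _; rewrite fE => x Jx; apply: JP => K [_]; apply.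
by exists i.
Qed.

HB.instance Definition _ := Choice.on Spec.
HB.instance Definition _ :=
  isOpenTopological.Build Spec Spec_openT Spec_openI Spec_open_bigU.

End Spectrum.

Section Filters.
Variables (Gamma : groupType) (M : gammaMonoidType Gamma).

Definition Fil : Type := [set F : set M | gamma_filter F].

Definition Fil_filter (F : Fil) : set M := set_val F.

Definition FilD (J : set M) : set Fil := [set F | J `&` Fil_filter F !=set0].

Lemma FilD_cover : \bigcup_(J in @gamma_order_ideal Gamma M) FilD J = setT.
Proof.
apply/seteqP; split=> // F _; exists setT; first exact: gamma_order_idealT.
by case: (set_valP F) => -[x Fx] _ _ _; exists x.
Qed.

Lemma FilD_join (J1 J2 : set M) (F : Fil) :
  gamma_order_ideal J1 -> gamma_order_ideal J2 -> FilD J1 F -> FilD J2 F ->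
  exists J, [/\ gamma_order_ideal J, FilD J F & FilD J `<=` FilD J1 `&` FilD J2].
Proof.
move=> J1i J2i [x [J1x Fx]] [y [J2y Fy]].
exists (J1 `&` J2); split; first exact: gamma_order_idealI.
  case: (set_valP F) => _ _ _ /(_ x y Fx Fy)[a [b [z [Fz zx zy]]]].
  exists z; split=> //; split.
    by case: (J1i) => _ _ d1 _; apply: d1 zx _; exact: gamma_order_ideal_sact.
  by case: (J2i) => _ _ d2 _; apply: d2 zy _; exact: gamma_order_ideal_sact.
by move=> G [z [[J1z J2z] Gz]]; split; exists z.
Qed.

HB.instance Definition _ := Choice.on Fil.
HB.instance Definition _ :=
  isBaseTopological.Build Fil FilD_cover FilD_join.

(* As a [set_type] of a topological space, it has the subspace topology. *)
Definition PFil : Type := [set F : Fil | prime_gamma_filter (Fil_filter F)].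

HB.instance Definition _ := Topological.on PFil.

Definition PFil_filter (F : PFil) : set M := Fil_filter (set_val F).

End Filters.

Definition homeomorphism (X Y : topologicalType) (f : X -> Y) : Prop :=
  continuous f /\
  exists g : Y -> X, [/\ cancel f g, cancel g f & continuous g].

(* Main.v *)
Require Import Defs.
From mathcomp Require Import all_boot all_order all_algebra finmap.
From mathcomp Require Import all_classical topology.

Local Open Scope classical_set_scope.

(** If P is prime and x, y lie outside P, then neither of the principal
    Gamma-order ideals generated by x and by y is contained in P, so their
    intersection meets the complement of P; this is (F3). Conversely, (F3) makes
    any two order ideals that meet the filter meet it at a common point. Under
    complementation the open set Spec \ V(J) corresponds to D(J), so the
    topologies match. *)

Section Complement.
Set Implicit Arguments.
Unset Strict Implicit.

Variables (Gamma : groupType) (M : gammaMonoidType Gamma).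
Implicit Types (J P : set M) (x y z : M) (s : seq Gamma).

Import GRing.Theory.
Local Open Scope ring_scope.

Lemma alg_le_trans x y z : alg_le x y -> alg_le y z -> alg_le x z.
Proof. by move=> [u ->] [v ->]; exists (u + v); rewrite addrA. Qed.

Lemma gact_alg_le (g : Gamma) x y : alg_le x y -> alg_le (gact g x) (gact g y).
Proof. by move=> [u ->]; exists (gact g u); rewrite gactD. Qed.

(** Take as coefficient of [g] its multiplicity in [s]; grouping equal terms turns the sum over [s]
    into the sum over the support of [a]. *)
Lemma sact_of_seq s : exists a : natGroupRing Gamma,
  forall x, sact a x = \sum_(g <- s) gact g x.
Proof.
pose a : natGroupRing Gamma := [fsfun g in seq_fset tt s => count_mem g s].
have aE g : a g = count_mem g s.
  (* Off [s] the default value 0 agrees with the multiplicity. *)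
  rewrite fsfunE seq_fsetE; case: ifPn => // gNs.
  by apply/esym/eqP; rewrite -leqn0 leqNgt -has_count has_pred1.
exists a => x; rewrite /sact.
rewrite -(big_undup_iterop_count _ s xpredT) (perm_big (undup s)) /=.
  by apply: eq_bigr => g _; rewrite aE.
apply: uniq_perm; rewrite ?fset_uniq ?undup_uniq// => g.
by rewrite mem_finsupp aE mem_undup -lt0n -has_count has_pred1.
Qed.

(* Finite families of group elements, repetitions allowed, stand for the
   elements of N[Gamma]: sums become concatenations. *)
Definition principal_ideal x : set M :=
  [set z | exists s, alg_le z (\sum_(g <- s) gact g x)].

Lemma principal_idealP x : gamma_order_ideal (principal_ideal x).
Proof.
split.
- by exists [::]; rewrite big_nil; exists 0; rewrite addr0.
- move=> y z [s [u su]] [t [v tv]]; exists (s ++ t); exists (u + v).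
  by rewrite big_cat /= su tv addrACA.
- by move=> y z yz [s zs]; exists s; exact: alg_le_trans yz zs.
(* Left translation of the family by [g] applies [gact g] to the whole sum, since [gact g] is
   additive. *)
- move=> g y [s ys]; exists [seq (g * h)%g | h <- s].
  rewrite big_map (eq_bigr (fun h => gact g (gact h x))); last first.
    by move=> h _; rewrite gactM.
  by rewrite -(big_morph _ (gactD g) (gact0 g)); exact: gact_alg_le.
Qed.

Lemma principal_ideal_gen x : principal_ideal x x.
Proof. by exists [:: 1%g]; rewrite big_seq1 gact1; exists 0; rewrite addr0. Qed.

Lemma prime_ideal_filter P :
  prime_gamma_order_ideal P -> prime_gamma_filter (~` P).
Proof.
move=> [[P0 PD Pd Pg] PT Pp]; split; last first.
  by move=> x y NPxy; apply/not_andP => -[Px Py]; apply/NPxy/PD.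
split.
- by apply/set0P/eqP => /(congr1 setC); rewrite setCK setC0.
- split=> [|g x NPx Pgx]; first exact.
  (* The inverse of [g] would bring [x] back into [P]. *)
  by apply: NPx; rewrite -(gact1 x) -(mulVg g) gactM; exact: Pg.
- by move=> x y NPx xy Py; apply: NPx; exact: Pd xy Py.
- move=> x y NPx NPy.
  have [z [[[s zs] [t zt]] NPz]] :
      exists z, (principal_ideal x `&` principal_ideal y) z /\ ~ P z.
    apply: contrapT => /forallNP PI.
    case: (Pp _ _ (principal_idealP x) (principal_idealP y)).
    + by move=> z zxy; apply: contrapT => NPz; exact: (PI z).
    + by move/(_ _ (principal_ideal_gen x)).
    + by move/(_ _ (principal_ideal_gen y)).
  have [a aE] := sact_of_seq s; have [b bE] := sact_of_seq t.
  by exists a, b, z; rewrite aE bE.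
Qed.

Lemma prime_filter_ideal P :
  prime_gamma_filter (~` P) -> prime_gamma_order_ideal P.
Proof.
move=> [[[w NPw] [NP0 NPg] NPu NPd] NPp]; split.
- split.
  + exact: contrapT.
  + by move=> x y Px Py; apply: contrapT => /NPp[].
  + by move=> x y xy Py; apply: contrapT => NPx; exact: NPu NPx xy Py.
  + move=> g x Px; apply: contrapT => NPgx.
    by have := NPg g^-1%g _ NPgx; rewrite -gactM mulVg gact1; exact.
- by move=> PT; apply: NPw; rewrite PT.
- move=> J1 J2 J1i J2i J12P; apply: contrapT => /not_orP[].
  move=> /existsNP[x /not_implyP[J1x NPx]] /existsNP[y /not_implyP[J2y NPy]].
  have [a [b [z [NPz zx zy]]]] := NPd x y NPx NPy.
  apply: NPz; apply: J12P; split.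
    by case: (J1i) => _ _ d1 _; apply: d1 zx _; exact: gamma_order_ideal_sact.
  by case: (J2i) => _ _ d2 _; apply: d2 zy _; exact: gamma_order_ideal_sact.
Qed.

Lemma PFil_filterP (F : PFil M) : prime_gamma_filter (PFil_filter F).
Proof. exact: (set_valP F). Qed.

Lemma Spec_idealP (P : Spec M) : prime_gamma_order_ideal (Spec_ideal P).
Proof. exact: (set_valP P). Qed.

Lemma Spec_ideal_inj : injective (@Spec_ideal _ M).
Proof. by move=> P Q PQ; exact/val_inj. Qed.

Lemma PFil_filter_inj : injective (@PFil_filter _ M).
Proof. by move=> F G FG; do 2 apply/val_inj. Qed.

(** [PFil] is a subtype of the subtype [Fil], hence two nested membership proofs, both extracted
    from [Fp]. *)
Definition mkPFil (F : set M) (Fp : prime_gamma_filter F) : PFil M :=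
  SigSub (mem_set (Fp : [set F : Fil M | prime_gamma_filter (Fil_filter F)]
    (SigSub (mem_set (proj1 Fp : [set F : set M | gamma_filter F] F))))).

Definition mkSpec P (Pp : prime_gamma_order_ideal P) : Spec M :=
  SigSub (mem_set (Pp : [set P : set M | prime_gamma_order_ideal P] P)).

Definition Spec_PFil (P : Spec M) : PFil M :=
  mkPFil (prime_ideal_filter (Spec_idealP P)).

(** The double complement is the form in which [prime_filter_ideal] applies to the complement of
    [F]. *)
Lemma prime_filterC (F : PFil M) : prime_gamma_filter (~` ~` PFil_filter F).
Proof. by rewrite setCK; exact: PFil_filterP. Qed.

Definition PFil_Spec (F : PFil M) : Spec M :=
  mkSpec (prime_filter_ideal (prime_filterC F)).

Lemma Spec_PFilE (P : Spec M) : PFil_filter (Spec_PFil P) = ~` Spec_ideal P.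
Proof. by []. Qed.

Lemma PFil_SpecE F : Spec_ideal (PFil_Spec F) = ~` PFil_filter F.
Proof. by []. Qed.

Lemma Spec_PFilK : cancel Spec_PFil PFil_Spec.
Proof.
by move=> P; apply: Spec_ideal_inj; rewrite PFil_SpecE Spec_PFilE setCK.
Qed.

Lemma PFil_SpecK : cancel PFil_Spec Spec_PFil.
Proof.
by move=> F; apply: PFil_filter_inj; rewrite Spec_PFilE PFil_SpecE setCK.
Qed.

(** This puts the basic open sets of the spectrum in the shape of [FilD J], read through
    complementation. *)
Lemma setC_SpecV J : ~` SpecV J = [set P : Spec M | J `&` ~` Spec_ideal P !=set0].
Proof.
apply/seteqP; split=> P /=; first by move/nonsubset.
by move=> [x [Jx NPx]] /(_ x Jx).
Qed.

Lemma open_setC_SpecV J : gamma_order_ideal J -> open (~` @SpecV _ M J).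
Proof. by exists J; rewrite ?setCK. Qed.

Lemma open_FilD J : gamma_order_ideal J -> open (@FilD _ M J).
Proof.
by exists [set J]; rewrite ?bigcup_set1// => _ ->.
Qed.

Lemma Spec_PFil_continuous : continuous Spec_PFil.
Proof.
(* An open set of [PFil M] is the trace of a union of sets [FilD J] with [J] in [D], so each
   [FilD J] can be treated separately. *)
apply/continuousP => _ [_ [D DJ <-] <-].
rewrite !preimage_bigcup; apply: bigcup_open => J DJJ.
have -> : Spec_PFil @^-1` (set_val @^-1` FilD J) = ~` SpecV J.
  by rewrite setC_SpecV.
exact/open_setC_SpecV/DJ.
Qed.

Lemma PFil_Spec_continuous : continuous PFil_Spec.
Proof.
apply/continuousP => U [J Ji UE].
(* [U] is the complement of [SpecV J], so its preimage is the trace of [FilD J] on the prime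
   filters. *)
exists (FilD J); first exact: open_FilD.
rewrite -(setCK U) UE setC_SpecV; apply/seteqP.
by split=> F /=; rewrite PFil_SpecE setCK.
Qed.

End Complement.

Theorem proposition4p5 (Gamma : groupType) (M : gammaMonoidType Gamma) :
  (forall J : set M, J <> setT ->
     (prime_gamma_order_ideal J <-> prime_gamma_filter (~` J)))
  /\
  (exists phi : Spec M -> PFil M,
     (forall J : Spec M, PFil_filter (phi J) = ~` Spec_ideal J) /\
     homeomorphism phi).
Proof.
split=> [J _|].
  by split; [exact: prime_ideal_filter|exact: prime_filter_ideal].
exists (@Spec_PFil Gamma M); split; first exact: Spec_PFilE.
split; first exact: Spec_PFil_continuous.
exists (@PFil_Spec Gamma M); split.
- exact: Spec_PFilK.
- exact: PFil_SpecK.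
- exact: PFil_Spec_continuous.
Qed.
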